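(* Let $f:\mathbb R^d\to\mathbb R^c$ and $\ell:\mathbb R^c\to\mathbb R$ be smooth, let $L=\ell\circ f$, and let $H:\mathbb R^d\times\mathbb R^p\to\mathbb R^d$ be such that $H(\cdot,\lambda)$ is smooth for every $\lambda\in\mathbb R^p$. Suppose $f(H(\theta,\lambda))=f(\theta)$ for all $\theta\in\mathbb R^d$ and $\lambda\in\mathbb R^p$. Fix $\lambda_0\in\mathbb R^p$ and let $\theta\in\mathrm{Fix}(H,\lambda_0)$. Define $\widehat X=\nabla_\theta H(\theta,\lambda_0)$. Then: 1. (First-order identity) $\nabla L(\theta)\circ\widehat X=\nabla L(\theta)$. 2. (Second-order identity) $\nabla^2L(\theta)\circ\widehat X\circ_2\widehat X=\nabla^2L(\theta)-\nabla L(\theta)\circ\nabla_\theta^2H(\theta,\lambda_0)$.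
   Context: $\mathrm{Fix}(H,\lambda_0)$ is the union of all fixed-point sets of $H$ at $\lambda_0$, where $\mathcal S\subseteq\mathbb R^d$ is a fixed-point set of $H$ at $\lambda_0$ if $H(\theta,\lambda_0)=\theta$ for all $\theta\in\mathcal S$; equivalently $\mathrm{Fix}(H,\lambda_0)=\{\theta:H(\theta,\lambda_0)=\theta\}$. No regularity of $H$ in $\lambda$ is assumed. $\nabla_\theta$ and $\nabla_\theta^2$ are the first and second Fréchet derivatives in the first argument. Tensor notation: tensors are curried multilinear maps; $\circ$ feeds the output of the right factor into the first input slot of the left factor and $\circ_2$ feeds it into the second input slot (chains read left to right). Evaluated on $v,w\in\mathbb R^d$, the two identities read $DL(\theta)[D_\theta H(\theta,\lambda_0)v]=DL(\theta)[v]$ and $D^2L(\theta)[D_\theta H(\theta,\lambda_0)v,\,D_\theta H(\theta,\lambda_0)w]=D^2L(\theta)[v,w]-DL(\theta)\big[D_\theta^2H(\theta,\lambda_0)[v,w]\big]$. *)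

(* Defs.v *)
From HB Require Import structures.
From mathcomp Require Import all_boot all_order all_algebra.
From mathcomp Require Import all_classical all_reals all_analysis.

Set Implicit Arguments.
Unset Strict Implicit.
Unset Printing Implicit Defensive.

Import Order.TTheory GRing.Theory Num.Theory.
Import numFieldNormedType.Exports.

Local Open Scope ring_scope.
Local Open Scope classical_set_scope.

Section ContinuousLinearMaps.
Context {R : realType} {V W : normedModType R}.

Definition clinear_pred : {pred V -> W} :=
  [pred u | `[< linear u /\ continuous u >]].

Lemma clinear_submod_closed : submod_closed clinear_pred.
Proof.
split; first by apply/asboolP; split=> [k x y|]; [rewrite scaler0 addr0|exact: cst_continuous].
move=> k u v /asboolP[lu cu] /asboolP[lv cv]; apply/asboolP; split.
  move=> a x y; rewrite !fctE lu lv.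
  by rewrite !scalerDr !scalerA [k * a]mulrC addrACA.
move=> x; apply: (@cvgD _ _ _ _ _ (k \*: u) v); last exact: cv.
by apply: cvgZl_tmp; exact: cu.
Qed.

HB.instance Definition _ :=
  GRing.isSubmodClosed.Build R (V -> W) clinear_pred clinear_submod_closed.

End ContinuousLinearMaps.

Record clinear (R : realType) (V W : normedModType R) := Clinear {
  clinear_fun :> V -> W ;
  clinear_funP : clinear_fun \in @clinear_pred R V W }.

Notation "''L' ( V , W )" := (@clinear _ V W)
  (at level 8, format "''L' ( V ,  W )") : type_scope.

Section OperatorNorm.
Context {R : realType} {V W : normedModType R}.

HB.instance Definition _ := [isSub for @clinear_fun R V W].
HB.instance Definition _ := [Choice of 'L(V, W) by <:].
HB.instance Definition _ := [SubChoice_isSubLmodule of 'L(V, W) by <:].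

Definition opnorm (u : 'L(V, W)) : R :=
  sup [set `|u v| | v in [set v : V | `|v| <= 1]].

Lemma clinear_linear (u : 'L(V, W)) : linear u.
Proof. by have /asboolP[] := clinear_funP u. Qed.

Lemma clinear_continuous (u : 'L(V, W)) : continuous u.
Proof. by have /asboolP[] := clinear_funP u. Qed.

HB.instance Definition _ (u : 'L(V, W)) :=
  GRing.isLinear.Build R V W *:%R (clinear_fun u) (clinear_linear u).

Lemma opnorm_has_sup (u : 'L(V, W)) :
  has_sup [set `|u v| | v in [set v : V | `|v| <= 1]].
Proof.
split; first by exists `|u 0|; exists 0 => //=; rewrite normr0.
have /linear_bounded_continuous/bounded_funP/(_ 1)[M uM] := @clinear_continuous u.
by exists M => _ [v v1 <-]; exact: uM.
Qed.

Lemma opnorm_ub (u : 'L(V, W)) (v : V) : `|v| <= 1 -> `|u v| <= opnorm u.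
Proof. by move=> v1; apply: sup_ubound; [case: (opnorm_has_sup u)|exists v]. Qed.

Lemma opnorm_le (u : 'L(V, W)) (M : R) :
  (forall v, `|v| <= 1 -> `|u v| <= M) -> opnorm u <= M.
Proof.
by move=> uM; apply: ge_sup; [case: (opnorm_has_sup u)|move=> _ [v v1 <-]; exact: uM].
Qed.

Lemma ler_opnorm (u : 'L(V, W)) (v : V) : `|u v| <= opnorm u * `|v|.
Proof.
have [->|v0] := eqVneq v 0; first by rewrite linear0 !normr0 mulr0.
rewrite -ler_pdivrMr ?normr_gt0//.
have -> : `|u v| / `|v| = `|u (`|v|^-1 *: v)|.
  by rewrite linearZ/= normrZ ger0_norm ?invr_ge0// mulrC.
apply: opnorm_ub.
by rewrite normrZ ger0_norm ?invr_ge0// mulVf// normr_eq0.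
Qed.

Lemma opnormD (u v : 'L(V, W)) : opnorm (u + v) <= opnorm u + opnorm v.
Proof.
apply: opnorm_le => x x1.
by rewrite (le_trans (ler_normD (u x) (v x)))// lerD// opnorm_ub.
Qed.

Lemma opnormZ_le (k : R) (u : 'L(V, W)) : opnorm (k *: u) <= `|k| * opnorm u.
Proof.
apply: opnorm_le => x x1.
by rewrite [`|_|](normrZ k (u x)) ler_wpM2l// opnorm_ub.
Qed.

Lemma opnormZ (k : R) (u : 'L(V, W)) : opnorm (k *: u) = `|k| * opnorm u.
Proof.
apply/eqP; rewrite eq_le opnormZ_le/=.
have [->|k0] := eqVneq k 0.
  by rewrite normr0 mul0r scale0r (le_trans _ (opnorm_ub 0 (v := 0) _))// ?normr0.
rewrite -ler_pdivlMl ?normr_gt0// -normfV.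
by rewrite -[in leLHS](scalerK k0 u) opnormZ_le.
Qed.

Lemma opnorm_eq0 (u : 'L(V, W)) : opnorm u = 0 -> u = 0.
Proof.
move=> u0; apply/val_inj/funext => v /=; apply/eqP.
by rewrite -normr_le0 (le_trans (ler_opnorm u v))// u0 mul0r.
Qed.

HB.instance Definition _ :=
  Lmodule_isNormed.Build R 'L(V, W) opnormD opnormZ opnorm_eq0.

End OperatorNorm.

(* The Frechet derivative as a map [V -> 'L(V, W)], so that it can itself be
   differentiated: [frechet (frechet f) x : 'L(V, 'L(V, W))] is the second
   derivative at [x], a curried bilinear map whose first argument is the
   direction in which [frechet f] is differentiated.  The differential ['d f x]
   is linear by typing, and continuous as soon as [f] is differentiable at [x],
   hence [frechetE]; the default value [0] is only reached when ['d f x] is not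
   continuous. *)
Definition frechet (R : realType) (V W : normedModType R) (f : V -> W) (x : V) :
  'L(V, W) := insubd (0 : 'L(V, W)) ('d f x : V -> W).

Lemma frechetE (R : realType) (V W : normedModType R) (f : V -> W) (x : V) :
  differentiable f x -> frechet f x = 'd f x :> (V -> W).
Proof.
move=> df; rewrite /frechet val_insubd ifT//; apply/asboolP; split.
  by move=> k u v; rewrite linearP.
exact: diff_continuous.
Qed.

Fixpoint class_C (k : nat) (R : realType) (V W : normedModType R)
    (f : V -> W) : Prop :=
  if k is k'.+1 then
    (forall x, differentiable f x) /\ class_C k' (frechet f)
  else continuous f.

Definition smooth (R : realType) (V W : normedModType R) (f : V -> W) : Prop :=
  forall k, class_C k f.

Section FixedPoints.
Context {T P : Type} (H : T -> P -> T) (l : P).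

Definition fixed_point_set (S : set T) : Prop :=
  forall theta, S theta -> H theta l = theta.

Definition Fix : set T := \bigcup_(S in fixed_point_set) S.

End FixedPoints.

(* Main.v *)
(** [L] is invariant under [H0 = H(-, lambda0)], so both identities come from
differentiating [L \o H0 = L] once and twice at the fixed point. The
second-order chain rule used for this is the Leibniz rule for the continuous
bilinear composition of operators, applied to
[D(g \o f) = (Dg \o f) . Df]. *)
Require Import Defs.
From HB Require Import structures.
From mathcomp Require Import all_boot all_order all_algebra.
From mathcomp Require Import all_classical all_reals all_analysis.
Import Order.TTheory GRing.Theory Num.Theory.
Import numFieldNormedType.Exports.
Local Open Scope ring_scope.
Local Open Scope classical_set_scope.

Section Composition.
Context {R : realType} {U V W : normedModType R}.

Lemma clinear_compP (g : 'L(V, W)) (h : 'L(U, V)) :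
  g \o h \in @clinear_pred R U W.
Proof.
apply/asboolP; split=> [k x y|x]; first by rewrite /= !linearP.
apply: continuous_comp; exact: clinear_continuous.
Qed.

Definition clinear_comp (g : 'L(V, W)) (h : 'L(U, V)) : 'L(U, W) :=
  @Clinear R U W (g \o h) (clinear_compP g h).

(** Stated in this form so that [clinear_comp] can be registered as a bilinear map, which gives
    access to [linearBl], [differentiable_bilin] and [diff_bilin]. *)
Lemma clinear_comp_bilinear :
  bilinear_for
    (GRing.Scale.Law.clone _ _ *:%R _) (GRing.Scale.Law.clone _ _ *:%R _)
    clinear_comp.
Proof.
split=> [h|g] k x y; apply/val_inj/funext => u //=.
by rewrite linearP.
Qed.

HB.instance Definition _ := bilinear_isBilinear.Build R 'L(V, W) 'L(U, V)
  'L(U, W) _ _ clinear_comp clinear_comp_bilinear.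

Lemma clinear_comp_norm_le (g : 'L(V, W)) (h : 'L(U, V)) :
  `|clinear_comp g h| <= `|g| * `|h|.
Proof.
apply: opnorm_le => u u1; rewrite (le_trans (ler_opnorm g (h u)))//.
by apply: ler_wpM2l; [exact: (@normr_ge0 _ 'L(V, W) g)|exact: opnorm_ub].
Qed.

(** A continuous bilinear map is differentiable; this supplies the continuity, by a squeeze resting
    on submultiplicativity of the operator norm. *)
Lemma clinear_comp_continuous :
  continuous (fun p : 'L(V, W) * 'L(U, V) => clinear_comp p.1 p.2).
Proof.
move=> [g h]; apply/subr_cvg0/norm_cvg0P => /=.
apply: (@squeeze_cvgr _ _ _ _ (cst 0)
  (fun p : 'L(V, W) * 'L(U, V) => `|p.1 - g| * `|p.2| + `|g| * `|p.2 - h|)).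
- near=> p; rewrite normr_ge0/=.
  (* Telescoping through the mixed term [clinear_comp g p.2], so that each summand contains one
     factor tending to zero. *)
  have -> : clinear_comp p.1 p.2 - clinear_comp g h =
      clinear_comp (p.1 - g) p.2 + clinear_comp g (p.2 - h).
    by rewrite linearBl linearBr addrA subrK.
  rewrite (le_trans (ler_normD _ _))//.
  by rewrite lerD ?clinear_comp_norm_le.
- exact: cvg_cst.
- have fstg : `|p.1 - g| @[p --> (g, h)] --> (0 : R).
    by apply/norm_cvg0P/subr_cvg0; exact: cvg_fst.
  have sndh : `|p.2 - h| @[p --> (g, h)] --> (0 : R).
    by apply/norm_cvg0P/subr_cvg0; exact: cvg_snd.
  (* The limit takes the shape of the bound, to be matched by the sum and product rules. *)
  have -> : 0 = 0 * `|h| + `|g| * 0 :> R by rewrite mul0r mulr0 addr0.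
  apply: cvgD; apply: cvgM => //; last exact: cvg_cst.
  by apply: cvg_norm; exact: cvg_snd.
Unshelve. all: by end_near. Qed.

End Composition.

Section ChainRule.
Context {R : realType} {U V W : normedModType R}.

Lemma frechet_comp (f : U -> V) (g : V -> W) (x : U) :
  differentiable f x -> differentiable g (f x) ->
  frechet (g \o f) x = clinear_comp (frechet g (f x)) (frechet f x).
Proof.
move=> df dg; apply: val_inj => /=.
by rewrite !frechetE//; [rewrite diff_comp|exact: differentiable_comp].
Qed.

Lemma differentiable_clinear_comp (T : normedModType R)
    (g : T -> 'L(V, W)) (h : T -> 'L(U, V)) (x : T) :
  differentiable g x -> differentiable h x ->
  differentiable (fun y => clinear_comp (g y) (h y)) x.
Proof.
move=> dg dh.
apply: (@differentiable_comp _ _ _ _ (fun y => (g y, h y))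
  (fun p => clinear_comp p.1 p.2)); first exact: differentiable_pair.
by apply: differentiable_bilin; exact: clinear_comp_continuous.
Qed.

(** Leibniz rule: the chain rule through the pairing [y |-> (g y, h y)], followed by the
    differential of a bilinear map. *)
Lemma frechet_clinear_comp (T : normedModType R)
    (g : T -> 'L(V, W)) (h : T -> 'L(U, V)) (x v : T) :
  differentiable g x -> differentiable h x ->
  frechet (fun y => clinear_comp (g y) (h y)) x v =
  clinear_comp (frechet g x v) (h x) + clinear_comp (g x) (frechet h x v).
Proof.
move=> dg dh; rewrite !frechetE//; last exact: differentiable_clinear_comp.
have cc := @clinear_comp_continuous R U V W.
rewrite (@diff_comp _ _ _ _ (fun y => (g y, h y))
  (fun p => clinear_comp p.1 p.2))/=; last 2 first.
- exact: differentiable_pair.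
- exact: differentiable_bilin.
(* [diff_bilin] lists first the term that varies the second factor, hence [addrC]. *)
by rewrite diff_bilin// diff_pair//= addrC.
Qed.

End ChainRule.

Section SecondOrderChainRule.
Context {R : realType} {U V W : normedModType R}.

(** An equality of functions, so that it can be rewritten under a further [frechet]; hence
    differentiability is assumed everywhere. *)
Lemma frechet_comp_fun (f : U -> V) (g : V -> W) :
  (forall x, differentiable f x) -> (forall y, differentiable g y) ->
  frechet (g \o f) =
  fun x => clinear_comp ((frechet g \o f) x) (frechet f x).
Proof. by move=> df dg; apply/funext => x; exact: frechet_comp. Qed.

Lemma differentiable_frechet_comp (f : U -> V) (g : V -> W) (x : U) :
  (forall x, differentiable f x) -> (forall y, differentiable g y) ->
  differentiable (frechet f) x -> differentiable (frechet g) (f x) ->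
  differentiable (frechet (g \o f)) x.
Proof.
move=> df dg d2f d2g; rewrite frechet_comp_fun//.
apply: differentiable_clinear_comp => //.
exact: differentiable_comp.
Qed.

Lemma frechet2_comp (f : U -> V) (g : V -> W) (x v w : U) :
  (forall x, differentiable f x) -> (forall y, differentiable g y) ->
  differentiable (frechet f) x -> differentiable (frechet g) (f x) ->
  frechet (frechet (g \o f)) x v w =
  frechet (frechet g) (f x) (frechet f x v) (frechet f x w) +
  frechet g (f x) (frechet (frechet f) x v w).
Proof.
move=> df dg d2f d2g; rewrite frechet_comp_fun//.
rewrite frechet_clinear_comp//; last exact: differentiable_comp.
(* The chain rule for [frechet g \o f] turns the first Leibniz term into the Hessian term of [g]. *)
by rewrite frechet_comp.
Qed.

End SecondOrderChainRule.

Section InvariantFunction.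
Context {R : realType} {V W : normedModType R}.
Context (L : V -> W) (h : V -> V) (x : V).
Context (Lh : L \o h = L) (hx : h x = x).
Context (dL : forall y, differentiable L y)
  (dh : forall y, differentiable h y).

Lemma frechet_invariant (v : V) : frechet L x (frechet h x v) = frechet L x v.
Proof.
have := frechet_comp h L x (dh x) (dL (h x)).
by rewrite Lh hx => /(congr1 (fun u : 'L(V, W) => u v)) /= <-.
Qed.

Lemma frechet2_invariant (v w : V) :
  differentiable (frechet L) x -> differentiable (frechet h) x ->
  frechet (frechet L) x (frechet h x v) (frechet h x w) =
  frechet (frechet L) x v w - frechet L x (frechet (frechet h) x v w).
Proof.
(* Differentiability of [frechet L] is left as a premise at [h x], so that rewriting with [hx] moves
   it to [x], where [d2L] applies. *)
move=> d2L d2h; have := frechet2_comp h L x v w dh dL d2h.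
by rewrite Lh hx => /(_ d2L) ->; rewrite addrK.
Qed.

End InvariantFunction.

Theorem theorem2 (R : realType) (d c p : nat)
    (f : 'rV[R]_d -> 'rV[R]_c) (ell : 'rV[R]_c -> R)
    (H : 'rV[R]_d -> 'rV[R]_p -> 'rV[R]_d)
    (f_smooth : smooth f) (ell_smooth : smooth ell)
    (H_smooth : forall lambda : 'rV[R]_p, smooth (fun theta => H theta lambda))
    (f_invariant : forall theta lambda, f (H theta lambda) = f theta)
    (lambda0 : 'rV[R]_p) (theta : 'rV[R]_d)
    (theta_fix : Fix H lambda0 theta) :
  let L : 'rV[R]_d -> R := ell \o f in
  let H0 : 'rV[R]_d -> 'rV[R]_d := fun t => H t lambda0 in
  let DL := frechet L theta in
  let D2L := frechet (frechet L) theta in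
  let X := frechet H0 theta in
  let D2H := frechet (frechet H0) theta in
  (forall v : 'rV[R]_d, DL (X v) = DL v) /\
  (forall v w : 'rV[R]_d, D2L (X v) (X w) = D2L v w - DL (D2H v w)).
Proof.
move=> L H0 DL D2L X D2H.
(* Order 2 of smoothness yields differentiability of each map and of its derivative, as the
   second-order chain rule requires. *)
have [df [d2f _]] := f_smooth 2.
have [dell [d2ell _]] := ell_smooth 2.
have [dH [d2H _]] := H_smooth lambda0 2.
have H0theta : H0 theta = theta by have [S fixS /fixS] := theta_fix.
have LH0 : L \o H0 = L by apply/funext => t; rewrite /L /H0 /= f_invariant.
have dL t : differentiable L t by exact: differentiable_comp.
have d2L t : differentiable (frechet L) t by exact: differentiable_frechet_comp.
split=> [v|v w]; first exact: (frechet_invariant L H0).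
exact: (frechet2_invariant L H0).
Qed.
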